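(* Let $\mathscr{I}$ be a non-empty set. For each $i\in\mathscr{I}$ let $\lambda_i\geqslant 1$ be a cardinal, let $S_i$ be a countably pracompact semiregular semitopological monoid with zero, and let $B^0_{\lambda_i}(S_i)$ be a semiregular countably pracompact topological Brandt $\lambda_i^0$-extension of $S_i$. Suppose that the Tychonoff product $\prod\{S_i\colon i\in\mathscr{I}\}$ is a countably pracompact space. Then the direct product $\prod\{B^0_{\lambda_i}(S_i)\colon i\in\mathscr{I}\}$ with the Tychonoff topology is a semiregular countably pracompact semitopological semigroup.
   Context: All topological spaces are Hausdorff. A semitopological semigroup is a Hausdorff topological space with a separately continuous associative operation; a semitopological monoid is a semitopological semigroup with identity. Direct products of semigroups carry the coordinatewise operation. Brandt $\lambda^0$-extension: for a monoid $S$ with zero $0_S$ and a cardinal $\lambda\geqslant 1$, $B^0_\lambda(S)$ is the set $\{(\alpha,s,\beta)\colon \alpha,\beta\in\lambda,\ s\in S\setminus\{0_S\}\}\sqcup\{0\}$ with the operation in which $0$ is the zero and $(\alpha,a,\beta)\cdot(\gamma,b,\delta)$ equals $(\alpha,ab,\delta)$ if $\beta=\gamma$ and $ab\neq 0_S$, and equals $0$ otherwise. For $\alpha,\beta\in\lambda$ put $S_{\alpha,\beta}=\{(\alpha,s,\beta)\colon s\in S\setminus\{0_S\}\}\cup\{0\}$. Topological Brandt $\lambda^0$-extension: for a semitopological monoid $(S,\tau)$ with zero, it is $B^0_\lambda(S)$ with a Hausdorff topology $\tau_B$ such that $(B^0_\lambda(S),\tau_B)$ is a semitopological semigroup and, for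 some $\alpha\in\lambda$, the map $0_S\mapsto 0$, $s\mapsto(\alpha,s,\alpha)$ ($s\neq 0_S$) is a homeomorphism of $(S,\tau)$ onto the subspace $S_{\alpha,\alpha}$. A subset $A$ of a space $X$ is regular open if $\operatorname{int}_X(\operatorname{cl}_X(A))=A$; a space is semiregular if it has a base of regular open subsets. A space $X$ is countably compact at a subset $A\subseteq X$ if every infinite subset $B\subseteq A$ has an accumulation point in $X$; $X$ is countably pracompact if it is countably compact at some dense subset $A$ of $X$. *)

(* Defs.v *)
From HB Require Import structures.
From mathcomp Require Import all_boot all_classical.
From mathcomp Require Import topology.

Set Implicit Arguments.
Unset Strict Implicit.
Unset Printing Implicit Defensive.

Local Open Scope classical_set_scope.
Local Open Scope group_scope.

HB.mixin Record Monoid_hasZero S of Monoid S := {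
  mzero : S;
  mul0m : left_zero mzero (@mul S);
  mulm0 : right_zero mzero (@mul S)
}.

#[short(type="monoid0Type")]
HB.structure Definition Monoid0 := {S of Monoid S & Monoid_hasZero S}.

(* Joins of an algebraic structure and a topology, with no compatibility
   between the two: the latter is the predicate [semitopological] below. *)
#[short(type="topologizedSemigroupType")]
HB.structure Definition TopologizedSemigroup :=
  {S of Semigroup S & Topological S}.

#[short(type="topologizedMonoid0Type")]
HB.structure Definition TopologizedMonoid0 :=
  {S of Monoid0 S & Topological S}.

(* Associativity is part of [topologizedSemigroupType]. *)
Definition semitopological (S : topologizedSemigroupType) : Prop :=
  [/\ hausdorff_space S,
      forall a : S, continuous (fun x : S => a * x) &
      forall a : S, continuous (fun x : S => x * a)].

Section product_semigroup.
Variables (I : Type) (T : I -> topologizedSemigroupType).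

Definition pprod_mul (x y : prod_topology T) : prod_topology T :=
  fun i => x i * y i.

Lemma pprod_mulA : associative pprod_mul.
Proof. by move=> x y z; apply: functional_extensionality_dep => i; exact: mulgA. Qed.

HB.instance Definition _ := isSemigroup.Build (prod_topology T) pprod_mulA.
End product_semigroup.

(* A copy of [T] carrying the topology [tau]; [Topological T] is the type of
   topologies on [T]. *)
Definition with_topology (T : Type) (tau : Topological T) : Type := T.

HB.instance Definition _ (T : Type) (tau : Topological T) :=
  Topological.copy (with_topology tau) (Topological.Pack tau).

HB.instance Definition _ (T : semigroupType) (tau : Topological T) :=
  isSemigroup.Build (with_topology tau) (@mulgA T).

Section brandt.
Variables (L : choiceType) (S : monoid0Type).

(* [None] is the zero of the extension. *)
Definition brandt0 : Type := option (L * {s : S | s != mzero} * L).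

HB.instance Definition _ := Choice.copy brandt0 (option (L * {s : S | s != mzero} * L)).

(* The triple (a, s, b), or zero when s = 0_S. *)
Definition brandt_elt (a : L) (s : S) (b : L) : brandt0 :=
  if insub s is Some s' then Some (a, s', b) else None.

Definition brandt_mul (x y : brandt0) : brandt0 :=
  match x, y with
  | Some (a, s, b), Some (c, t, d) =>
      if b == c then brandt_elt a (val s * val t) d else None
  | _, _ => None
  end.

Lemma brandt_mulA : associative brandt_mul.
Proof.
have elt0 a b : brandt_elt a mzero b = None.
  by rewrite /brandt_elt insubF // eqxx.
have eltM a s b c t d : brandt_mul (brandt_elt a s b) (brandt_elt c t d) =
    if b == c then brandt_elt a (s * t) d else None.
  rewrite {1 2}/brandt_elt; case: insubP => [u _ us|/negPn/eqP ->]; last first.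
    by rewrite mul0m elt0; case: ifP.
  case: insubP => [v _ vt|/negPn/eqP ->] /=; last by rewrite mulm0 elt0; case: ifP.
  by rewrite us vt.
have eltE (x : brandt0) : x = None \/ exists a s b, x = brandt_elt a s b.
  case: x => [[[a s] b]|]; [right|by left].
  by exists a, (val s), b; rewrite /brandt_elt valK.
have mul0 x : brandt_mul x None = None by case: x => [[[]]|].
move=> x y z.
have [->//|[a [s [b ->]]]] := eltE x.
have [->|[c [t [d ->]]]] := eltE y; first by rewrite mul0.
have [->|[e [u [f ->]]]] := eltE z; first by rewrite !mul0.
rewrite !eltM; case: (eqVneq b c) => bc; case: (eqVneq d e) => de;
  by rewrite ?mul0 ?eltM ?bc ?de ?eqxx ?mulgA ?(negbTE bc) ?(negbTE de).
Qed.

HB.instance Definition _ := isSemigroup.Build brandt0 brandt_mulA.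

Definition brandt_block (a b : L) : set brandt0 :=
  [set brandt_elt a s b | s in [set s | s != mzero]] `|` [set None].

End brandt.

Definition homeomorphism_onto (X Y : topologicalType) (A : set Y) (f : X -> Y) :=
  exists g : Y -> X,
    [/\ range f = A, cancel f g, continuous f & {within A, continuous g}].

Definition topological_brandt (L : choiceType) (S : topologizedMonoid0Type)
    (tau : Topological (brandt0 L S)) : Prop :=
  semitopological (with_topology tau) /\
  exists a : L,
    @homeomorphism_onto S (with_topology tau) (brandt_block a a)
      (fun s => brandt_elt a s a).

Definition semiregular (X : topologicalType) : Prop :=
  exists B : set (set X), basis B /\ B `<=` @regopen X.

Definition countably_compact_at (X : topologicalType) (A : set X) : Prop :=
  forall B : set X, B `<=` A -> infinite_set B -> limit_point B !=set0.

Definition countably_pracompact (X : topologicalType) : Prop :=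
  exists A : set X, dense A /\ countably_compact_at A.

(* Main.v *)
Require Import Defs.
From mathcomp Require Import all_boot finmap all_classical.
From mathcomp Require Import topology.
(** Separate continuity is checked coordinatewise, and semiregularity passes to
products because projections are continuous and open, hence pull regular open
sets back to regular open sets, while regular open sets are stable under finite
intersections.

Countable pracompactness of the product rests on the shape of the topology of a
factor [B^0_L(S)] near its zero. Every nonzero block
[{(a, s, b) | s <> 0}] is open, and every neighbourhood [U] of the zero
contains all but finitely many of them ([nbhs_brandt0_cofinite]): one may take
[U] regular open, so a block that is not inside [U] is not even inside the
closure of [U]; if there were infinitely many such blocks, a dense set
witnessing countable pracompactness would have a point outside the closure of
[U] in each of them, and those points would accumulate neither at the zero nor
at a nonzero point, whose block contains only one of them.

Consequently, let [(a_n, s_n, b_n)] be elements whose middle terms converge to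
[s] along an ultrafilter [G]. Either the pair of indices is [G]-almost always
equal to some [(a, b)], and the elements converge to [(a, s, b)]; or it leaves
every finite set of pairs, and they converge to the zero
([brandt_elt_ultra_cvg]).

Now let [A] be a dense subset of the product of the [S_i] at which that product
is countably compact, and let [D] consist of all families
[(alpha_i, s_i, beta_i)_i] with [s] in [A] and arbitrary indices. Fixing the
indices gives a continuous map from the product of the [S_i], and these maps
jointly cover the product of the extensions, so [D] is dense. For a sequence in
[D], the corresponding sequence in [A] converges along some free ultrafilter;
by the dichotomy above every coordinate of the given sequence then converges
along the same ultrafilter, hence so does the sequence itself. *)

Set Implicit Arguments.
Unset Strict Implicit.
Unset Printing Implicit Defensive.

Local Open Scope classical_set_scope.
Local Open Scope group_scope.

(** * Countable compactness at a subset, through ultrafilters *)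

(** The ultrafilter lives on the index type, so that it can be used to take
limits of several families indexed by [T] at once. *)
Lemma cluster_map_ultra (T : Type) (X : topologicalType) (F : set_system T)
    (f : T -> X) (x : X) :
  Filter F -> cluster (f @ F) x ->
  exists G : set_system T, [/\ UltraFilter G, F `<=` G & f @ G --> x].
Proof.
move=> FF clx.
pose H := filter_from [set AU : set T * set X | F AU.1 /\ nbhs x AU.2]
  (fun AU => AU.1 `&` f @^-1` AU.2).
have HF : ProperFilter H.
  apply: filter_from_proper; first apply: filter_from_filter.
  - by exists (setT, setT); split; exact: filterT.
  - move=> [A U] [B V] [/= FA xU] [/= FB xV]; exists (A `&` B, U `&` V).
      by split; exact: filterI.
    by move=> t [[At Bt] [Ut Vt]].
  - move=> [A U] [/= FA xU].
    have [_ [[t At <-] Uft]] : f @` A `&` U !=set0.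
      apply: clx xU; rewrite -[_ _]/(F (f @^-1` (f @` A))).
      by apply: filterS FA => t At; exists t.
    by exists t.
have [G [GU HG]] := ultraFilterLemma HF.
exists G; split=> // [A FA|U xU]; apply: HG.
  by exists (A, setT) => [|t []//]; split=> //; exact: filterT.
by exists (setT, U) => [|t []//]; split=> //; exact: filterT.
Qed.

(** Sequences need not be injective here. One with finite range clusters because
finite sets are compact; for one with infinite range, closedness of finite sets
forces every neighbourhood of a limit point of the range to be visited at
arbitrarily large times. Conversely, an infinite set contains the range of an
injective sequence. *)
Lemma countably_compact_atP (X : topologicalType) (A : set X) :
  accessible_space X ->
  countably_compact_at A <->
  forall u : nat -> X, (forall n, A (u n)) ->
    exists (G : set_system nat) (x : X),
      [/\ UltraFilter G, \oo `<=` G & u @ G --> x].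
Proof.
move=> T1; split=> [Acc u Au|Aseq B BA Binf].
  suff [x /cluster_map_ultra[G GP]] : exists x, cluster (u @ \oo) x by exists G, x.
  have [ufin|uinf] := pselect (finite_set (range u)).
    have [|x [_ ?]] := finite_compact ufin (F := u @ \oo); last by exists x.
      by exists 0%N => // n _; exists n.
  have [x xlim] : limit_point (range u) !=set0 by apply: Acc => // _ [n _ <-].
  exists x => V U [N _ NV] xU.
  (* Removing the first N values, except x, forces a visit at time N or later. *)
  pose E := (u @` `I_N) `\ x.
  have xE : nbhs x (~` E).
    apply: open_nbhs_nbhs; split; last by case=> _; apply.
    apply: closed_openC; apply: (iffLR accessible_finite_set_closed T1).
    by apply: finite_setD; apply: finite_image; exact: finite_II.
  have [y [yx [m _ umy] [Uy nEy]]] := xlim _ (filterI xU xE).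
  exists y; split=> //; rewrite -umy; apply: NV => /=.
  rewrite leqNgt; apply/negP => mN; apply: nEy; split; last exact/eqP.
  by exists m.
have /infiniteP/card_leP/unsquash g := Binf.
pose f n : X := set_val (g (to_setT n)).
have fB n : B (f n) by exact: set_valP.
have finj : injective f by move=> m n /val_inj/inj-/(_ (in_setT _) (in_setT _)) [].
have [G [x [GU Goo fx]]] := Aseq f (fun n => BA _ (fB n)).
exists x => U xU.
(* If x is a value of f, it is taken once: a later index avoids it. *)
have [[n fnx]|] := pselect (exists n, f n = x); last first.
  move=> nfx; have [n Un] := @filter_ex _ G _ (f @^-1` U) (fx _ xU).
  by exists (f n); split=> //; apply/eqP => fnx; apply: nfx; exists n.
have Gn : G [set k | (n < k)%N] by apply: Goo; exists n.+1.
have [k [Uk /= nk]] := filter_ex (@filterI _ G _ (f @^-1` U) _ (fx _ xU) Gn).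
exists (f k); split=> //; rewrite -fnx; apply/eqP => /finj kn.
by move: nk; rewrite kn ltnn.
Qed.

(** * Products of semitopological semigroups and of semiregular spaces *)

Lemma cvg_prod_coord (I : choiceType) (T : I -> topologicalType)
    (F : set_system (prod_topology T)) (x : prod_topology T) :
  Filter F -> (forall i, (fun f => f i) @ F --> x i) -> F --> x.
Proof.
move=> FF Fx; apply/cvg_sup => i A [_ [[W oW <-] Wx WA]].
by apply: filterS WA _; apply: Fx; exact: open_nbhs_nbhs.
Qed.

Lemma prod_continuous (I : choiceType) (X : topologicalType)
    (T : I -> topologicalType) (f : X -> prod_topology T) :
  (forall i, continuous (fun x => f x i)) -> continuous f.
Proof. by move=> fc x; apply: cvg_prod_coord => i; exact: fc. Qed.

Lemma regopen_open (X : topologicalType) (U : set X) : regopen U -> open U.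
Proof. by move=> <-; exact: open_interior. Qed.

Lemma open_sub_regularization (X : topologicalType) (U : set X) :
  open U -> U `<=` (closure U)°.
Proof. by move=> oU; rewrite -open_subsetE //; exact: subset_closure. Qed.

Lemma regopenI (X : topologicalType) (U V : set X) :
  regopen U -> regopen V -> regopen (U `&` V).
Proof.
move=> rU rV; rewrite /regopen eqEsubset; split.
  rewrite -{2}rU -{2}rV -interiorI; apply: interiorS; exact: closureI.
by apply: open_sub_regularization; apply: openI; exact: regopen_open.
Qed.

(** Continuity maps the closure of the preimage of [V] into the closure of [V],
and openness makes the image of its interior an open set, hence a subset of the
interior of the closure of [V], which is [V]. *)
Lemma regopen_preimage (X Y : topologicalType) (f : X -> Y) (V : set Y) :
  continuous f -> (forall A, open A -> open (f @` A)) ->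
  regopen V -> regopen (f @^-1` V).
Proof.
move=> fc fo rV; rewrite /regopen eqEsubset; split; last first.
  apply: open_sub_regularization; move/continuousP: fc; apply; exact: regopen_open.
move=> x xi; rewrite /preimage /= -rV.
have oi : open (f @` (closure (f @^-1` V))°) by apply: fo; exact: open_interior.
have : f @` (closure (f @^-1` V))° `<=` closure V.
  move=> _ [y /interior_subset yc <-] W fyW.
  by have [z [Vz Wz]] := yc _ (fc _ _ fyW); exists (f z).
rewrite open_subsetE //; apply; by exists x.
Qed.

(** The filter at [x] generated by the regular open sets around it. Being a
filter, its convergence to [x] can be tested coordinatewise in a product. *)
Definition regopen_nbhs (X : topologicalType) (x : X) : set_system X :=
  filter_from [set U | regopen U /\ U x] id.

Lemma regopen_nbhs_filter (X : topologicalType) (x : X) : Filter (regopen_nbhs x).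
Proof.
apply: filter_from_filter.
  by exists setT; split=> //; rewrite /regopen closureT interiorT.
move=> U V [rU Ux] [rV Vx]; exists (U `&` V) => //; split=> //.
exact: regopenI.
Qed.

Lemma semiregularP (X : topologicalType) :
  semiregular X <-> forall x : X, regopen_nbhs x --> x.
Proof.
split=> [[B [[_ Bx] Breg]] x U /Bx[V [BV Vx] VU]|reg].
  by exists V => //; split=> //; exact: Breg.
exists (@regopen X); split=> //; split=> // U; exact: regopen_open.
Qed.

Lemma semiregular_prod (I : choiceType) (T : I -> topologicalType) :
  (forall i, semiregular (T i)) -> semiregular (prod_topology T).
Proof.
move=> Treg; apply/semiregularP => x.
have FF := regopen_nbhs_filter x.
apply: cvg_prod_coord => i U xiU.
have /semiregularP/(_ (x i) _ xiU)[V [rV Vxi] VU] := Treg i.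
exists ((fun f : prod_topology T => f i) @^-1` V) => [|y /VU//].
split=> //; apply: regopen_preimage => //.
  exact: (@proj_continuous I T i).
by move=> A oA; exact: (@proj_open I T i).
Qed.

Lemma semitopological_prod (I : choiceType) (T : I -> topologizedSemigroupType) :
  (forall i, semitopological (T i)) -> semitopological (prod_topology T).
Proof.
move=> Tst; split.
- by apply: (@hausdorff_product I T) => i; have [] := Tst i.
- move=> a; apply: prod_continuous => i x.
  apply: (@continuous_comp _ _ _ (fun f : prod_topology T => f i) (fun t => a i * t)).
    exact: (@proj_continuous I T i).
  by have [_ lc _] := Tst i; exact: lc.
- move=> a; apply: prod_continuous => i x.
  apply: (@continuous_comp _ _ _ (fun f : prod_topology T => f i) (fun t => t * a i)).
    exact: (@proj_continuous I T i).
  by have [_ _ rc] := Tst i; exact: rc.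
Qed.

(** * The topology of a Brandt extension *)

Section brandt_algebra.
Variables (L : choiceType) (S : monoid0Type).
Implicit Types (a b c d : L) (s t : S).

Lemma brandt_elt0 a b : brandt_elt a (mzero : S) b = None.
Proof. by rewrite /brandt_elt insubF // eqxx. Qed.

Lemma brandt_elt_val a (s : {s : S | s != mzero}) b :
  brandt_elt a (val s) b = Some (a, s, b).
Proof. by rewrite /brandt_elt valK. Qed.

Lemma brandt_elt_mul a s b c t d :
  (brandt_elt a s b : brandt0 L S) * brandt_elt c t d =
  if b == c then brandt_elt a (s * t) d else None.
Proof.
rewrite [LHS]/(brandt_mul _ _) {1 2}/brandt_elt.
case: insubP => [u _ us|/negPn/eqP ->]; last first.
  by rewrite mul0m brandt_elt0; case: ifP.
case: insubP => [v _ vt|/negPn/eqP ->] /=; last by rewrite mulm0 brandt_elt0; case: ifP.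
by rewrite us vt.
Qed.

Lemma brandt_eltP a0 (x : brandt0 L S) : exists a s b, x = brandt_elt a s b.
Proof.
case: x => [[[a s] b]|]; first by exists a, (val s), b; rewrite brandt_elt_val.
by exists a0, mzero, a0; rewrite brandt_elt0.
Qed.

Definition brandt_cell a b : set (brandt0 L S) :=
  [set x | exists s : {s : S | s != mzero}, x = Some (a, s, b)].

(** A cell is the locus where a continuous map is nonzero: multiplying by the
idempotents [(a, 1, a)] and [(b, 1, b)] keeps its elements and annihilates all
others. *)
Lemma brandt_cellE a b :
  brandt_cell a b =
  [set x | (brandt_elt a 1 a : brandt0 L S) * x * brandt_elt b 1 b <> None].
Proof.
rewrite eqEsubset; split=> [_ [s ->]|x] /=.
  by rewrite -brandt_elt_val !(brandt_elt_mul, eqxx, mul1g, mulg1) brandt_elt_val.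
case: x => [[[c s] d]|]; last first.
  rewrite -(brandt_elt0 a b) !(brandt_elt_mul, eqxx, mulm0, mul0m, brandt_elt0).
  by move=> /(_ erefl).
rewrite -brandt_elt_val brandt_elt_mul.
case: eqVneq => [<-|_ /(_ erefl)//]; rewrite mul1g brandt_elt_mul.
by case: eqVneq => [<-|_ /(_ erefl)//] _; exists s; rewrite brandt_elt_val.
Qed.

End brandt_algebra.

Section brandt_topology.
Variables (L : choiceType) (S : topologizedMonoid0Type).
Variable tau : Topological (brandt0 L S).
Hypothesis tauB : topological_brandt tau.
Local Notation B := (with_topology tau).

(** The hypothesis gives one diagonal block [(c, c)]; the others are
translates of it, as [(a, 1, c) (c, s, c) (c, 1, b) = (a, s, b)]. *)
Lemma brandt_elt_continuous (a b : L) :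
  continuous (fun s : S => brandt_elt a s b : B).
Proof.
have [[_ lc rc] [c [g [_ _ ec _]]]] := tauB.
have -> : (fun s : S => brandt_elt a s b : B) =
    fun s => (brandt_elt a 1 c : B) * (brandt_elt c s c : B) * (brandt_elt c 1 b : B).
  apply/funext => s.
  have := brandt_elt_mul a 1 c c s c; rewrite eqxx mul1g => e1.
  have := brandt_elt_mul a s c c 1 b; rewrite eqxx mulg1 => e2.
  by rewrite -[RHS]/((_ : brandt0 L S) * _ * _) e1 e2.
move=> s; apply: (@continuous_comp S B B _ (fun x => x * (brandt_elt c 1 b : B))).
  apply: (@continuous_comp S B B _ (fun x => (brandt_elt a 1 c : B) * x)).
    exact: ec.
  exact: lc.
exact: rc.
Qed.

Lemma brandt_cell_open (a b : L) : open (brandt_cell a b : set B).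
Proof.
have [[T2 lc rc] _] := tauB.
rewrite brandt_cellE.
pose f (x : B) : B := (brandt_elt a 1 a : B) * x * (brandt_elt b 1 b : B).
have fc : continuous f.
  move=> x; apply: (@continuous_comp B B B _ (fun y => y * (brandt_elt b 1 b : B))).
    exact: lc.
  exact: rc.
apply: (@open_comp B B f (~` [set None : B])); first by move=> x _; exact: fc.
by apply: closed_openC; apply: accessible_closed_set1; exact: hausdorff_accessible.
Qed.

(** A cell not contained in a regular open neighbourhood [V] of the zero is, as
an open set, not contained in the closure of [V] either. Infinitely many such
cells would give infinitely many points of the dense set [A], one per cell and
away from [V], with no possible limit point. *)
Lemma nbhs_brandt0_cofinite (U : set B) :
  semiregular B -> countably_pracompact B -> nbhs (None : B) U ->
  finite_set [set p : L * L | ~ brandt_cell p.1 p.2 `<=` U].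
Proof.
have [[T2 _ _] _] := tauB; have T1 := hausdorff_accessible T2.
move=> /semiregularP reg [A [Adense Acc]] /reg[V [rV V0] VU].
apply: (@sub_finite_set _ _ [set p : L * L | ~ brandt_cell p.1 p.2 `<=` V]).
  by move=> p /= npU pV; apply: npU; exact: subset_trans VU.
apply: contrapT => Pinf; set P := [set p | _] in Pinf.
have meetA p : P p ->
    exists x : B, [/\ A x, brandt_cell p.1 p.2 x & ~ closure V x].
  move=> Pp.
  have [||x [[px Vx] Ax]] := @Adense (brandt_cell p.1 p.2 `&` ~` closure V).
  - apply: contrapT => ne; apply: Pp.
    suff : brandt_cell p.1 p.2 `<=` (closure V)° by rewrite rV.
    rewrite -(open_subsetE _ (brandt_cell_open p.1 p.2)).
    by move=> x px; apply: contrapT => nVx; apply: ne; exists x.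
  - apply: openI; first exact: brandt_cell_open.
    by apply: closed_openC; exact: closed_closure.
  by exists x.
have [d dP] : exists d : L * L -> B, forall p, P p ->
    [/\ A (d p), brandt_cell p.1 p.2 (d p) & ~ closure V (d p)].
  have /choice[d dP] : forall p, exists x : B, P p ->
      [/\ A x, brandt_cell p.1 p.2 x & ~ closure V x].
    move=> p; have [/meetA[x xP]|nPp] := pselect (P p); first by exists x.
    by exists None.
  by exists d.
have dcell p q : P p -> brandt_cell q.1 q.2 (d p) -> p = q.
  case: p q => [a b] [a' b'] /dP[_ /= [s ->] _] [t]; by case=> -> _ ->.
have [t tlim] : limit_point (d @` P) !=set0.
  apply: Acc => [_ [p /dP[Ap _ _] <-]//|].
  suff /eq_finite_set -> : (d @` P #= P)%card by [].
  apply: inj_card_eq => p q /set_mem Pp /set_mem Pq dpq.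
  by apply: dcell => //; rewrite dpq; have [] := dP _ Pq.
case: t => [[[a s] b]|] in tlim *; last first.
  have V0' : nbhs (None : B) V by apply: open_nbhs_nbhs; split=> //; exact: regopen_open.
  have [_ [_ [p Pp <-] Vdp]] := tlim V V0'.
  by have [_ _] := dP _ Pp; apply; exact: subset_closure.
(* Only d (a, b) can lie in the cell of a nonzero limit point; remove it. *)
pose E : set B := [set d (a, b)] `\ (Some (a, s, b) : B).
have tC : nbhs (Some (a, s, b) : B) (brandt_cell a b `&` ~` E).
  apply: open_nbhs_nbhs; split; last first.
    by split; [exists s|case=> _; apply].
  apply: openI; first exact: brandt_cell_open.
  apply: closed_openC; apply: (iffLR accessible_finite_set_closed T1).
  by apply: finite_setD; exact: finite_set1.
have [y [/eqP yt [p Pp dpy] [yab]]] := tlim _ tC; apply; split=> //=.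
by rewrite -dpy (dcell p (a, b)) // dpy.
Qed.

End brandt_topology.

(** * Limits along ultrafilters and the product of Brandt extensions *)

Lemma ultra_avoid_finite (T : Type) (I : choiceType) (G : set_system T)
    (c : T -> I) (P : set I) :
  UltraFilter G -> ~ (exists p, G (c @^-1` [set p])) -> finite_set P ->
  G (~` (c @^-1` P)).
Proof.
move=> GU Gn /finite_fsetP[X ->].
have Gp p : G (~` (c @^-1` [set p])).
  by have [Gp|//] := in_ultra_setVsetC (c @^-1` [set p]) GU; case: Gn; exists p.
have GX : G (\bigcap_(p in [set` X]) ~` (c @^-1` [set p])) by exact: filter_bigI.
by apply: filterS GX => t Xt /= ctX; exact: (Xt (c t)).
Qed.

Section brandt_limit.
Variables (L : choiceType) (S : topologizedMonoid0Type).
Variable tau : Topological (brandt0 L S).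
Hypothesis tauB : topological_brandt tau.
Local Notation B := (with_topology tau).
Hypothesis tau_cofinite : forall U : set B, nbhs (None : B) U ->
  finite_set [set p : L * L | ~ brandt_cell p.1 p.2 `<=` U].

(** Either the indices are constant on a member of [G], and the limit is the
image of [s0], or they leave every finite set, and the limit is the zero. *)
Lemma brandt_elt_ultra_cvg (T : Type) (G : set_system T) (c : T -> L * L)
    (s : T -> S) (s0 : S) :
  UltraFilter G -> s @ G --> s0 ->
  exists x : B, (fun t => brandt_elt (c t).1 (s t) (c t).2 : B) @ G --> x.
Proof.
move=> GU ss0.
have [[p Gp]|Gn] := pselect (exists p, G (c @^-1` [set p])).
  exists (brandt_elt p.1 s0 p.2) => U xU.
  have Gs : G ((fun t => brandt_elt p.1 (s t) p.2 : B) @^-1` U).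
    exact: ss0 (brandt_elt_continuous tauB xU).
  by apply: (@filterS _ G _ _ _ _ (filterI Gp Gs)) => t [] /= <-.
exists None => U xU.
have GU' := ultra_avoid_finite GU Gn (tau_cofinite xU).
apply: (@filterS _ G _ _ _ _ GU') => t /= /contrapT ctU.
have [st0|st0] := eqVneq (s t) mzero.
  by rewrite st0 brandt_elt0; exact: nbhs_singleton xU.
by apply: ctU; rewrite /brandt_elt; case: insubP => [v _ _|/negP//]; exists v.
Qed.

End brandt_limit.

Section brandt_product.
Variables (I : choiceType) (L : I -> choiceType).
Variables (S : I -> topologizedMonoid0Type).
Variable tau : forall i, Topological (brandt0 (L i) (S i)).
Local Notation B := (fun i : I => with_topology (tau i)).
Hypothesis tauB : forall i, topological_brandt (tau i).

Definition prod_brandt_elt (c : forall i, L i * L i) (s : prod_topology S) :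
  prod_topology B := fun i => brandt_elt (c i).1 (s i) (c i).2.

Lemma prod_brandt_elt_continuous c : continuous (prod_brandt_elt c).
Proof.
apply: prod_continuous => i s.
apply: (@continuous_comp _ _ (B i) (fun f : prod_topology S => f i)
  (fun x => brandt_elt (c i).1 x (c i).2)).
  exact: (@proj_continuous I S i).
exact: brandt_elt_continuous.
Qed.

(** The dense set consists of the images of a dense set of the product of the
[S i] under all the maps [prod_brandt_elt c]. *)
Lemma countably_pracompact_prod_brandt :
  (forall i, [set: L i] !=set0) ->
  (forall i (U : set (B i)), nbhs (None : B i) U ->
    finite_set [set p : L i * L i | ~ brandt_cell p.1 p.2 `<=` U]) ->
  (forall i, hausdorff_space (S i)) ->
  countably_pracompact (prod_topology S) -> countably_pracompact (prod_topology B).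
Proof.
move=> /(_ _)/cid-L0 tau0 ST2 [A [Adense Acc]].
exists [set x | exists c a, A a /\ x = prod_brandt_elt c a]; split.
  move=> O [x Ox] oO.
  have /(_ _)/cid-xE i : exists cs : (L i * L i) * S i,
      x i = brandt_elt cs.1.1 cs.2 cs.1.2.
    have [a [s [b ->]]] := brandt_eltP (sval (L0 i)) (x i).
    by exists ((a, b), s).
  pose c i := (sval (xE i)).1; pose s : prod_topology S := fun i => (sval (xE i)).2.
  have [||a [Oa Aa]] := @Adense (prod_brandt_elt c @^-1` O).
  - exists s; rewrite /preimage /=; suff -> : prod_brandt_elt c s = x by [].
    by apply: functional_extensionality_dep => i; rewrite (svalP (xE i)).
  - by move/continuousP: (@prod_brandt_elt_continuous c); apply.
  by exists (prod_brandt_elt c a); split=> //; exists c, a.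
apply/countably_compact_atP.
  apply: hausdorff_accessible; apply: (@hausdorff_product I B) => i.
  by have [[]] := tauB i.
(* The middle terms converge first; the ultrafilter so obtained then serves
   all coordinates, whatever the indices c n i do. *)
move=> u /choice[c /choice[a ua]].
have /countably_compact_atP Aseq := Acc.
have [||G [s [GU Goo as0]]] := Aseq _ a.
- by apply: hausdorff_accessible; exact: (@hausdorff_product I S).
- by move=> n; have [] := ua n.
have /(_ _)/cid-lim i : exists x : B i, (fun n => u n i) @ G --> x.
  have -> : (fun n => u n i) =
      fun n => brandt_elt (c n i).1 (a n i) (c n i).2.
    by apply/funext => n; have [_ ->] := ua n.
  apply: (@brandt_elt_ultra_cvg _ _ _ (tauB i) (tau0 i) _ G (fun n => c n i)
    (fun n => a n i) (s i)).
  exact: (@cvg_comp _ _ _ a (fun f : prod_topology S => f i) G _ _ as0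
    (@proj_continuous I S i s)).
exists G, (fun i => sval (lim i)); split=> //.
by apply: cvg_prod_coord => i; exact: svalP (lim i).
Qed.

End brandt_product.

Theorem theorem2p15 (I : choiceType) (L : I -> choiceType)
    (S : I -> topologizedMonoid0Type)
    (tau : forall i : I, Topological (brandt0 (L i) (S i))) :
  [set: I] !=set0 ->
  (forall i : I, [set: L i] !=set0) ->
  (forall i : I, semitopological (S i)) ->
  (forall i : I, semiregular (S i)) ->
  (forall i : I, countably_pracompact (S i)) ->
  (forall i : I, topological_brandt (tau i)) ->
  (forall i : I, semiregular (with_topology (tau i))) ->
  (forall i : I, countably_pracompact (with_topology (tau i))) ->
  countably_pracompact (prod_topology S) ->
  [/\ semitopological (prod_topology (fun i : I => with_topology (tau i))),
      semiregular (prod_topology (fun i : I => with_topology (tau i))) &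
      countably_pracompact (prod_topology (fun i : I => with_topology (tau i)))].
Proof.
move=> _ L0 ST _ _ tauB tauR tauC SC; split.
- by apply: semitopological_prod => i; have [] := tauB i.
- exact: semiregular_prod.
- apply: countably_pracompact_prod_brandt SC => // [i U|i].
    exact: nbhs_brandt0_cofinite.
  by have [] := ST i.
Qed.
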